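(* For the transcendental numbers $\pi$ and $e$ and all $x>0$, $$D^e(x^\pi)=\frac{\Gamma(\pi+1)}{\Gamma(\pi-e+1)}x^{\pi-e},\qquad D^\pi(x^e)=\frac{\Gamma(e+1)}{\Gamma(e-\pi+1)}x^{e-\pi},$$ and the product $$D^e(x^\pi)\cdot D^\pi(x^e)=\frac{\Gamma(\pi+1)\,\Gamma(e+1)}{\Gamma(\pi-e+1)\,\Gamma(e-\pi+1)}$$ is independent of $x$.
   Context: For a real number $r>0$, the $r$-order integral operator $J^r$ is defined by $$J^r(f)(x)=\frac{1}{\Gamma(r)}\int_0^x (x-y)^{r-1}f(y)\,dy,\qquad x>0,$$ where $\Gamma$ is Euler's gamma function. For a positive integer $k$, $D^k$ is the ordinary $k$-th derivative with respect to $x$. For a real number $s>0$, $D^s$ is defined by choosing an integer $k>s$ and setting $D^s(f)(x)=D^kJ^{k-s}(f)(x)$ (the claim is to hold for every such choice of $k$). $D^s(x^p)$ denotes the value at $x$ of $D^s$ applied to the function $f(x)=x^p$; the product in the claim is the pointwise product of the two function values at $x$. *)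

(* Defs.v *)
From HB Require Import structures.
From mathcomp Require Import all_boot all_order all_algebra.
From mathcomp Require Import all_classical all_reals all_analysis.

Set Implicit Arguments.
Unset Strict Implicit.
Unset Printing Implicit Defensive.

Import Order.TTheory GRing.Theory Num.Theory.
Import numFieldNormedType.Exports.

Local Open Scope classical_set_scope.
Local Open Scope ring_scope.

(* Euler's integral, meaningful only for a > 0: for a <= 0 the integral
   diverges and [Rintegral] returns 0. *)
Definition Gamma (R : realType) (a : R) : R :=
  (\int[@lebesgue_measure R]_(t in `[0%R, +oo[) (t `^ (a - 1) * expR (- t)))%R.

(* Integrand of J^r(f)(x). When r < 1 the kernel is singular at y = x; the
   value [0 `^ (r - 1)] there only matters on a null set. *)
Definition RL_integrand (R : realType) (r : R) (f : R -> R) (x y : R) : R :=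
  (x - y) `^ (r - 1) * f y.

(* J^r(f)(x), intended for r > 0 and x > 0. *)
Definition RL_integral (R : realType) (r : R) (f : R -> R) (x : R) : R :=
  (Gamma r)^-1 *
  (\int[@lebesgue_measure R]_(y in `[0%R, x]) RL_integrand r f x y)%R.

(* D^s(f)(x) = D^k J^(k-s)(f)(x), for an integer k > s. *)
Definition RL_deriv (R : realType) (k : nat) (s : R) (f : R -> R) (x : R) : R :=
  ((RL_integral (k%:R - s) f)^`(k))%classic x.

(* [Rintegral] and [derive1n] are total functions. This predicate says that
   D^k J^(k-s)(f) really exists on ]0, +oo[: the integral converges and can be
   differentiated k times. *)
Definition RL_derivable (R : realType) (k : nat) (s : R) (f : R -> R) : Prop :=
  forall x : R, 0 < x ->
    (@lebesgue_measure R).-integrable `[0%R, x]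
      (fun y => (RL_integrand (k%:R - s) f x y)%:E) /\
    (forall j : nat, (j < k)%N ->
      derivable ((RL_integral (k%:R - s) f)^`(j))%classic x 1).

(* Main.v *)
(** Writing [truncpow a] for the function [t `^ (a - 1)] extended by [0] to
    [t <= 0], scaling shows that [truncpow a] and [truncpow b] convolve to
    [B(a, b)] times [truncpow (a + b)]. The same holds after multiplication by
    [expR (- t)], whence [Gamma a * Gamma b = B(a, b) * Gamma (a + b)] because
    the integral of a convolution is the product of the integrals. These
    identities are between extended reals and need no convergence; [b = 1] gives
    the recurrence [Gamma (a + 1) = a * Gamma a], then [Gamma n.+1 = n`!], and
    comparison with integers shows that [Gamma] is finite and positive.
    Hence [J^r (x^p) = Gamma (p + 1) / Gamma (p + r + 1) * x^(p + r)], and [k]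
    ordinary derivatives multiply this by a falling product which the recurrence
    absorbs into [Gamma] as long as [p + r - k > -1]. For the two derivatives of
    the theorem this means [|pi - e| < 1]. *)

Require Import Defs.
From HB Require Import structures.
From mathcomp Require Import all_boot all_order all_algebra.
From mathcomp Require Import all_classical all_reals all_analysis.
From mathcomp Require Import measurable_realfun ring lra.

Set Implicit Arguments.
Unset Strict Implicit.
Unset Printing Implicit Defensive.

Import Order.TTheory GRing.Theory Num.Theory.
Import numFieldNormedType.Exports.

Local Open Scope classical_set_scope.
Local Open Scope ring_scope.

Section lebesgue_integral_complements.
Context {R : realType}.
Local Notation mu := (@lebesgue_measure R).
Local Open Scope ereal_scope.

Lemma ge0_integral_affine (c d : R) (f : R -> \bar R) : (0 < c)%R ->
    measurable_fun [set: R] f -> (forall x, 0 <= f x) ->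
  \int[mu]_x f x = c%:E * \int[mu]_x f (c * x + d)%R.
Proof.
move=> c0 mf f0.
pose phi : measurableTypeR R -> measurableTypeR R := fun x => (c * x + d)%R.
have mphi : measurable_fun setT phi.
  by apply: measurable_funD => //; exact: measurable_funM.
pose cn : {nonneg R} := NngNum (ltW c0).
pose nu : {measure set (measurableTypeR R) -> \bar R} :=
  mscale cn (pushforward mu phi).
have mu_nu A : measurable A -> mu A = nu mphi A.
  apply: lebesgue_measure_unique => _ [[a b]] /= _ <-.
  have phi_itv : phi @^-1` `]a, b]%classic =
      `]((a - d) / c)%R, ((b - d) / c)%R]%classic.
    apply/seteqP; split => x; rewrite /= !in_itv /= /phi;
      by rewrite ltr_pdivrMr// ler_pdivlMr// ltrBlDr lerBrDr mulrC.
  transitivity (c%:E * mu (phi @^-1` `]a, b]%classic)); last by [].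
  rewrite phi_itv !lebesgue_measure_itv/= !lte_fin ltr_pM2r ?invr_gt0// ltrD2r.
  case: ifPn => _; last by rewrite mule0.
  by rewrite -!EFinB -EFinM; congr EFin; field; rewrite gt_eqF.
transitivity (\int[nu mphi]_x f x).
  by apply: eq_measure_integral => A mA _; exact: mu_nu.
by rewrite ge0_integral_mscale//= ge0_integral_pushforward.
Qed.

Lemma itvoc_bigcup (a b : R) : (a < b)%R ->
  `]a, b]%classic = \bigcup_n `[(a + (b - a) / n.+2%:R)%R, b]%classic.
Proof.
move=> ab; have ba0 : (0 < b - a)%R by rewrite subr_gt0.
apply/seteqP; split => x /=.
  rewrite in_itv/= => /andP[ax xb].
  have xa0 : (0 < x - a)%R by rewrite subr_gt0.
  exists (Num.truncn ((b - a) / (x - a))) => //=.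
  rewrite in_itv/= xb andbT -lerBrDl ler_pdivrMr// mulrC -ler_pdivrMr//.
  by rewrite ltW// (lt_le_trans (truncnS_gt _))// ler_nat.
move=> [n _] /=; rewrite !in_itv/= => /andP[+ ->]; rewrite andbT.
by apply: lt_le_trans; rewrite ltrDl divr_gt0.
Qed.

Lemma cvg_at_right_harmonic (f : R -> R) (a c l : R) : (0 < c)%R ->
    f x @[x --> a^'+] --> l ->
  f (a + c / n.+2%:R)%R @[n --> \oo] --> l.
Proof.
move=> c0 fl.
apply: ((cvg_at_rightP _ _ _).1 fl (fun n => a + c / n.+2%:R)%R).
split => [n|].
  by rewrite ltrDl divr_gt0.
rewrite -[X in _ --> X]addr0 -(mulr0 c); apply: cvgD; first exact: cvg_cst.
by apply: cvgMl_tmp; have := @cvg_harmonic R; rewrite -cvg_shiftS.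
Qed.

Lemma ge0_continuous_FTC2oc (f F : R -> R) (a b l : R) : (a < b)%R ->
    {in `]a, b], forall x, 0 <= f x}%R ->
    {within `]a, b], continuous f} ->
    {in `]a, b[%R, forall x : R, is_derive x 1%R F (f x)} ->
    F x @[x --> a^'+] --> l -> F x @[x --> b^'-] --> F b ->
  \int[mu]_(x in `]a, b]) (f x)%:E = (F b)%:E - l%:E.
Proof.
move=> ab f0 cf dF Fal Fb.
have a_lt n : (a < a + (b - a) / n.+2%:R)%R by rewrite ltrDl divr_gt0 ?subr_gt0.
have lt_b n : (a + (b - a) / n.+2%:R < b)%R.
  by rewrite -ltrBrDl ltr_pdivrMr// ltr_pMr ?subr_gt0// ltr1n.
have FTC n : \int[mu]_(x in `[(a + (b - a) / n.+2%:R)%R, b]) (f x)%:E =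
    (F b - F (a + (b - a) / n.+2%:R))%:E.
  have dFn (x : R) : x \in `](a + (b - a) / n.+2%:R)%R, b[%R ->
      is_derive x 1%R F (f x).
    move=> xnb; apply: dF; apply: subset_itvr xnb.
    by rewrite bnd_simp ltW.
  rewrite (@continuous_FTC2 _ _ F)//.
  - by apply: continuous_subspaceW cf; apply: subset_itvr; rewrite bnd_simp.
  - split=> [x /dFn[]//||//]; apply: cvg_at_right_filter.
    apply: differentiable_continuous; apply/derivable1_diffP.
    by apply: (@ex_derive _ _ _ _ _ _ _ (dF _ _)); rewrite in_itv/= a_lt lt_b.
  - by move=> x /dFn dFx; rewrite derive1E; case: dFx.
have mf : measurable_fun `]a, b] f by exact: subspace_continuous_measurable_fun.
pose I n : set R := `[(a + (b - a) / n.+2%:R)%R, b]%classic.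
have I_sub n : I n `<=` `]a, b] by apply: subset_itvr; rewrite bnd_simp.
have cvg_int : \int[mu]_(x in I n) (f x)%:E @[n --> \oo] -->
    \int[mu]_(x in \bigcup_n I n) (f x)%:E.
  apply: ge0_nondecreasing_set_cvg_integral => [|n|n|n x /I_sub xab].
  - apply/nondecreasing_seqP => n; rewrite subsetEset; apply: subset_itvr.
    by rewrite bnd_simp lerD2l ler_pM2l ?subr_gt0// lef_pV2 ?posrE// ler_nat.
  - exact: measurable_itv.
  - by apply/measurable_EFinP; exact: measurable_funS mf.
  - by rewrite lee_fin f0.
rewrite itvoc_bigcup//; apply: (cvg_unique _ cvg_int) => //=.
rewrite (funext FTC) -EFinB; apply: cvg_EFin; first exact: nearW.
apply: cvgB; first exact: cvg_cst.
by apply: cvg_at_right_harmonic => //; rewrite subr_gt0.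
Qed.

End lebesgue_integral_complements.

Section convolution.
Context {R : realType}.
Local Notation mu := (@lebesgue_measure R).
Local Open Scope ereal_scope.

Definition convolution (f g : R -> \bar R) (u : R) : \bar R :=
  \int[mu]_t (f t * g (u - t)%R).

Lemma measurable_convolution_integrand (f g : R -> \bar R) (u : R) :
    measurable_fun [set: R] f -> measurable_fun [set: R] g ->
  measurable_fun [set: R] (fun t => f t * g (u - t)%R).
Proof.
move=> mf mg; apply: emeasurable_funM => //.
by apply: measurableT_comp => //; exact: measurable_funB.
Qed.

Lemma ge0_integral_convolution (f g : R -> \bar R) :
    measurable_fun [set: R] f -> measurable_fun [set: R] g ->
    (forall t, 0 <= f t) -> (forall t, 0 <= g t) ->
  \int[mu]_u convolution f g u = (\int[mu]_t f t) * (\int[mu]_t g t).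
Proof.
move=> mf mg f0 g0.
pose F (z : R * R) := f z.1 * g (z.2 - z.1)%R.
have mF : measurable_fun [set: R * R] F.
  apply: emeasurable_funM; first exact: measurableT_comp.
  by apply: measurableT_comp => //; exact: measurable_funB.
have translation t : \int[mu]_u g (u - t)%R = \int[mu]_u g u.
  rewrite [RHS](@ge0_integral_affine _ 1 (- t))// mul1e.
  by under [RHS]eq_integral do rewrite mul1r.
rewrite -(@fubini_tonelli _ _ _ _ _ mu mu F)//; last first.
  by move=> z; rewrite mule_ge0.
rewrite muleC -ge0_integralZl//; last exact: integral_ge0.
apply: eq_integral => t _.
rewrite muleC -(translation t) -ge0_integralZl//.
by apply: measurableT_comp => //; exact: measurable_funB.
Qed.

End convolution.

Section truncated_power.
Context {R : realType}.
Local Notation mu := (@lebesgue_measure R).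
Implicit Types a b c t u : R.

(* With the exponent shifted by [1], the convolution of [truncpow a] and
   [truncpow b] is a multiple of [truncpow (a + b)]. *)
Definition truncpow a t : R := if 0 < t then t `^ (a - 1) else 0.

Lemma truncpow_gt0E a t : 0 < t -> truncpow a t = t `^ (a - 1).
Proof. by rewrite /truncpow => ->. Qed.

Lemma truncpow_le0 a t : t <= 0 -> truncpow a t = 0.
Proof. by rewrite /truncpow ltNge => ->. Qed.

Lemma truncpow_ge0 a t : 0 <= truncpow a t.
Proof. by rewrite /truncpow; case: ifP => // _; exact: powR_ge0. Qed.

Lemma measurable_truncpow a : measurable_fun [set: R] (truncpow a).
Proof. by apply: measurable_fun_ifT => //; exact: measurable_fun_ltr. Qed.

Lemma truncpowM a c t : 0 < c ->
  truncpow a (c * t) = c `^ (a - 1) * truncpow a t.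
Proof.
move=> c0; rewrite /truncpow pmulr_rgt0//; case: ifPn => [t0|_].
  by rewrite powRM// ltW.
by rewrite mulr0.
Qed.

Lemma truncpow1 t : truncpow 1 t = (0 < t)%R%:R.
Proof. by rewrite /truncpow subrr powRr0; case: ifP. Qed.

Lemma truncpow_le_add a b c t : a <= b <= c ->
  truncpow b t <= truncpow a t + truncpow c t.
Proof.
move=> /andP[ab bc]; rewrite /truncpow.
case: ifPn => [t0|_]; last by rewrite addr0.
have [t1|t1] := leP t 1.
  by rewrite -[leLHS]addr0 lerD ?powR_ge0// ger_powR ?t0// lerD2r.
by rewrite -[leLHS]add0r lerD ?powR_ge0// ler_powR ?(ltW t1)// lerD2r.
Qed.

Lemma measurable_truncpow_integrand a b u : measurable_fun [set: R]
  (fun t => (EFin \o truncpow a) t * (EFin \o truncpow b) (u - t)%R)%E.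
Proof.
by apply: measurable_convolution_integrand; apply/measurable_EFinP;
  exact: measurable_truncpow.
Qed.

Lemma truncpow_integrand_ge0 a b t u :
  (0 <= (EFin \o truncpow a) t * (EFin \o truncpow b) u)%E.
Proof. by rewrite mule_ge0 ?lee_fin ?truncpow_ge0. Qed.

Definition eBeta a b : \bar R :=
  convolution (EFin \o truncpow a) (EFin \o truncpow b) 1.

Lemma eBeta_ge0 a b : (0 <= eBeta a b)%E.
Proof. by apply: integral_ge0 => t _; exact: truncpow_integrand_ge0. Qed.

Lemma convolution_truncpow a b u :
  convolution (EFin \o truncpow a) (EFin \o truncpow b) u =
  ((truncpow (a + b) u)%:E * eBeta a b)%E.
Proof.
have [u0|u0] := ltP 0 u; last first.
  rewrite truncpow_le0// mul0e; apply: integral0_eq => t _ /=.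
  have [t0|t0] := ltP 0 t; last by rewrite truncpow_le0// mul0e.
  by rewrite (@truncpow_le0 b) ?mule0// subr_le0 (le_trans u0)// ltW.
rewrite /eBeta /convolution (@ge0_integral_affine _ u 0)//; last 2 first.
- exact: measurable_truncpow_integrand.
- by move=> t; exact: truncpow_integrand_ge0.
transitivity (u%:E * \int[mu]_t ((u `^ (a - 1) * u `^ (b - 1))%:E *
    ((truncpow a t)%:E * (truncpow b (1 - t))%:E)))%E.
  congr (_ * _)%E; apply: eq_integral => t _ /=; rewrite -!EFinM; congr EFin.
  rewrite addr0 truncpowM// (_ : u - u * t = u * (1 - t)); last by ring.
  by rewrite truncpowM//; ring.
rewrite ge0_integralZl//; last 3 first.
- exact: measurable_truncpow_integrand.
- by move=> t _; exact: truncpow_integrand_ge0.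
- by rewrite lee_fin mulr_ge0 ?powR_ge0.
rewrite muleA -EFinM; congr (_%:E * _)%E.
have u_neq0 : u != 0 by rewrite gt_eqF.
rewrite truncpow_gt0E// -[X in X * _](@powRr1 _ u) ?ltW//.
by rewrite -!powRD ?u_neq0 ?implybT//; congr (_ `^ _); ring.
Qed.

Lemma integral_powRB1 a b : 0 < a -> 0 < b ->
  (\int[mu]_(t in `]0%R, b]) (t `^ (a - 1))%:E = (a^-1 * b `^ a)%:E)%E.
Proof.
move=> a0 b0; pose F (t : R) := a^-1 * t `^ a.
have dF t : 0 < t -> is_derive t 1 F (t `^ (a - 1)).
  move=> t0; have := is_derive1_powR a t0.
  rewrite -[X in _ -> is_derive _ _ _ X](@mulKf _ a) ?gt_eqF//.
  exact: is_deriveZ.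
rewrite (@ge0_continuous_FTC2oc _ _ F 0 b 0)//.
- by rewrite sube0.
- by move=> t _; exact: powR_ge0.
- apply: derivable_within_continuous => t; rewrite in_itv/= => /andP[t0 _].
  by apply: derivable_powR; rewrite in_itv/= t0.
- by move=> t; rewrite in_itv/= => /andP[t0 _]; exact: dF.
- by rewrite -[X in _ --> X](mulr0 a^-1); apply: cvgMl_tmp; exact: powR_cvg0.
- apply/cvg_at_left_filter/differentiable_continuous/derivable1_diffP.
  by have [] := dF b b0.
Qed.

Lemma eBeta1r a : 0 < a -> eBeta a 1 = (a^-1)%:E.
Proof.
move=> a0; have -> : a^-1 = a^-1 * 1 `^ a by rewrite powR1 mulr1.
rewrite -integral_powRB1// -integral_itv_bndo_bndc; last first.
  by apply/measurable_EFinP; exact: measurable_funTS.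
rewrite integral_mkcond/=; apply: eq_integral => t _.
rewrite patchE mem_setE in_itv/= truncpow1 subr_gt0 /truncpow.
by case: (ltP 0 t); case: (ltP t 1); rewrite ?mul0e ?mule1 ?mule0.
Qed.

End truncated_power.

Section gamma_function.
Context {R : realType}.
Local Notation mu := (@lebesgue_measure R).
Implicit Types a b c q t u : R.

Definition gamma_fun a t : R := truncpow a t * expR (- t).

Let gamma_fun_ge0 a t : (0 <= (gamma_fun a t)%:E)%E.
Proof. by rewrite lee_fin mulr_ge0 ?truncpow_ge0 ?expR_ge0. Qed.

Let measurable_gamma_fun a :
  measurable_fun [set: R] (fun t => (gamma_fun a t)%:E).
Proof.
apply/measurable_EFinP; apply: measurable_funM.
  exact: measurable_truncpow.
exact: measurableT_comp.
Qed.

Definition eGamma a : \bar R := (\int[mu]_t (gamma_fun a t)%:E)%E.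

Lemma eGamma_ge0 a : (0 <= eGamma a)%E.
Proof. exact: integral_ge0. Qed.

Lemma convolution_gamma_fun a b u :
  convolution (EFin \o gamma_fun a) (EFin \o gamma_fun b) u =
  (eBeta a b * (gamma_fun (a + b) u)%:E)%E.
Proof.
transitivity ((expR (- u))%:E *
    convolution (EFin \o truncpow a) (EFin \o truncpow b) u)%E; last first.
  by rewrite convolution_truncpow muleA -EFinM muleC [expR _ * _]mulrC.
rewrite /convolution -ge0_integralZl//; last 2 first.
- exact: measurable_truncpow_integrand.
- by move=> t _; exact: truncpow_integrand_ge0.
apply: eq_integral => t _ /=; rewrite -!EFinM; congr EFin.
have -> : expR (- u) = expR (- t) * expR (- (u - t)).
  by rewrite -expRD; congr expR; ring.
by rewrite /gamma_fun; ring.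
Qed.

Lemma eGammaM a b : (eGamma a * eGamma b = eBeta a b * eGamma (a + b))%E.
Proof.
rewrite -ge0_integral_convolution//.
under eq_integral do rewrite convolution_gamma_fun.
by rewrite ge0_integralZl//; [exact: measurable_gamma_fun|exact: eBeta_ge0].
Qed.

Lemma eGammaE a :
  eGamma a = (\int[mu]_(t in `[0%R, +oo[) (t `^ (a - 1) * expR (- t))%:E)%E.
Proof.
rewrite -integral_itv_obnd_cbnd; last first.
  apply/measurable_EFinP/measurable_funTS/measurable_funM => //.
  exact: measurableT_comp.
rewrite [RHS]integral_mkcond; apply: eq_integral => t _.
rewrite patchE mem_setE in_itv/= andbT /gamma_fun /truncpow.
by case: ifP => // _; rewrite mul0r.
Qed.

Lemma eGamma1 : eGamma 1 = 1%E.
Proof.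
rewrite eGammaE -(@integral_exponential_pdf R 1)// integral_mkcond.
apply: eq_integral => t _; rewrite /exponential_pdf !patchE; case: ifP => // _.
by rewrite subrr powRr0 mulN1r.
Qed.

Lemma eGammaS a : 0 < a -> eGamma (a + 1) = (a%:E * eGamma a)%E.
Proof.
move=> a0; have := eGammaM a 1; rewrite eGamma1 mule1 eBeta1r// => ->.
by rewrite muleA -EFinM divff ?gt_eqF// mul1e.
Qed.

Lemma eGamma_nat n : eGamma n.+1%:R = (n`!%:R)%:E.
Proof.
elim: n => [|n IHn]; first by rewrite eGamma1.
by rewrite -natr1 eGammaS// IHn -EFinM factS natrM.
Qed.

Lemma eGamma_le_add a b c : a <= b <= c -> (eGamma b <= eGamma a + eGamma c)%E.
Proof.
move=> abc; rewrite /eGamma -ge0_integralD//; [|exact: measurable_gamma_fun..].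
apply: ge0_le_integral => //; first exact: measurable_gamma_fun.
  by apply: emeasurable_funD; exact: measurable_gamma_fun.
move=> t _; rewrite -EFinD lee_fin -mulrDl ler_wpM2r ?expR_ge0//.
exact: truncpow_le_add.
Qed.

Lemma eGamma_fin_num a : 0 < a -> eGamma a \is a fin_num.
Proof.
move=> a0; suff : eGamma (a + 1) \is a fin_num.
  rewrite eGammaS// => aG; rewrite -[eGamma a]mul1e -(@mulVf _ a) ?gt_eqF//.
  by rewrite EFinM -muleA fin_numM.
have an : a <= (Num.truncn a).+1%:R by rewrite ltW ?truncnS_gt.
rewrite ge0_fin_numE ?eGamma_ge0//.
apply: (le_lt_trans (@eGamma_le_add 1 _ (Num.truncn a).+2%:R _)).
  by rewrite lerDr ltW//= -[leRHS]natr1 lerD2r.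
by rewrite eGamma1 eGamma_nat -EFinD ltry.
Qed.

Lemma GammaE a : Gamma a = fine (eGamma a).
Proof. by rewrite eGammaE. Qed.

Lemma Gamma_fineK a : 0 < a -> (Gamma a)%:E = eGamma a.
Proof. by move=> a0; rewrite GammaE fineK ?eGamma_fin_num. Qed.

Lemma GammaS a : 0 < a -> Gamma (a + 1) = a * Gamma a.
Proof. by move=> a0; rewrite !GammaE eGammaS// fineM// eGamma_fin_num. Qed.

(* If [Gamma a] vanished, so would all [Gamma (a + n)], and between two of them
   lies some [m!]. *)
Lemma Gamma_gt0 a : 0 < a -> 0 < Gamma a.
Proof.
move=> a0; have aD n : 0 < a + n%:R by rewrite ltr_wpDr.
rewrite lt_neqAle -lee_fin Gamma_fineK// eGamma_ge0 andbT eq_sym.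
apply/negP => /eqP Ga0.
have GaD n : Gamma (a + n%:R) = 0.
  elim: n => [|n IHn]; first by rewrite addr0.
  by rewrite -natr1 addrA GammaS// IHn mulr0.
pose n := Num.truncn a.
have : a <= n.+1%:R <= a + n.+1%:R by rewrite ltW ?truncnS_gt// lerDr ltW.
move=> /eGamma_le_add; rewrite eGamma_nat -!Gamma_fineK// GaD Ga0 adde0 lee_fin.
by rewrite leNgt ltr0n fact_gt0.
Qed.

Lemma Gamma_falling q n : 0 < q - n%:R + 1 ->
  Gamma (q + 1) = \prod_(i < n) (q - i%:R) * Gamma (q - n%:R + 1).
Proof.
elim: n => [|n IHn] qn; first by rewrite big_ord0 mul1r subr0.
have q_n : q - n.+1%:R + 1 = q - n%:R by rewrite -natr1; ring.
rewrite q_n in qn *; rewrite big_ord_recr/= -mulrA -GammaS// -IHn//.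
by rewrite addr_gt0.
Qed.

Lemma eBetaE a b : 0 < a -> 0 < b ->
  eBeta a b = (Gamma a * Gamma b / Gamma (a + b))%:E.
Proof.
move=> a0 b0; have ab0 : 0 < a + b by rewrite addr_gt0.
rewrite EFinM [X in (_ = X * _)%E]EFinM !Gamma_fineK// eGammaM.
rewrite -(Gamma_fineK ab0) -muleA -EFinM divff ?mule1//.
by rewrite gt_eqF ?Gamma_gt0.
Qed.

End gamma_function.

Lemma near_eq_derive1n (R : numFieldType) (V : normedModType R) (f g : R -> V)
    (n : nat) (x : R) :
  (\near x, f x = g x) -> \near x, (f^`(n))%classic x = (g^`(n))%classic x.
Proof.
move=> fg; elim: n => [|n IHn]; first exact: fg.
near=> y; rewrite !derive1nS !derive1E; apply: near_eq_derive.
by near: y; exact: near_join IHn.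
Unshelve. all: by end_near. Qed.

Section iterated_derivative_of_powers.
Context {R : realType}.
Implicit Types c q x : R.

Let is_derive_monomial c q x : 0 < x ->
  is_derive x 1 (fun t => c * t `^ q) (c * (q * x `^ (q - 1))).
Proof. by move=> x0; have := is_derive1_powR q x0; exact: is_deriveZ. Qed.

Lemma derive1n_monomial c q n x : 0 < x ->
  ((fun t => c * t `^ q)^`(n))%classic x =
  c * \prod_(i < n) (q - i%:R) * x `^ (q - n%:R).
Proof.
elim: n x => [|n IHn] x x0; first by rewrite derive1n0 big_ord0 mulr1 subr0.
rewrite derive1nS derive1E.
pose g t := c * \prod_(i < n) (q - i%:R) * t `^ (q - n%:R).
rewrite (@near_eq_derive _ _ _ _ g); last first.
  by near=> y; apply: IHn; near: y; exact: lt_nbhsr.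
have [_ ->] := is_derive_monomial (c * \prod_(i < n) (q - i%:R)) (q - n%:R) x0.
by rewrite big_ord_recr/= -natr1 opprD addrA; ring.
Unshelve. all: by end_near. Qed.

Lemma derivable1n_monomial c q n x : 0 < x ->
  derivable ((fun t => c * t `^ q)^`(n))%classic x 1.
Proof.
move=> x0.
have [dx _] := is_derive_monomial (c * \prod_(i < n) (q - i%:R)) (q - n%:R) x0.
apply: near_eq_derivable dx.
by near=> y; apply/esym/derive1n_monomial; near: y; exact: lt_nbhsr.
Unshelve. all: by end_near. Qed.

End iterated_derivative_of_powers.

Section riemann_liouville_powers.
Context {R : realType}.
Local Notation mu := (@lebesgue_measure R).
Implicit Types p q r s x y : R.

Lemma measurable_RL_integrand_powR r p x :
  measurable_fun [set: R] (RL_integrand r (@powR R ^~ p) x).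
Proof.
apply: measurable_funM => //.
by apply: (measurableT_comp (measurable_powR (r - 1))); exact: measurable_funB.
Qed.

Lemma integral_RL_integrand_powR_convolution r p x :
  (\int[mu]_(y in `[0%R, x]) (RL_integrand r (@powR R ^~ p) x y)%:E =
   convolution (EFin \o truncpow (p + 1)) (EFin \o truncpow r) x)%E.
Proof.
rewrite (@integral_itv_bndoo _ _ _ _ true false); last first.
  apply/measurable_EFinP/measurable_funTS.
  exact: measurable_RL_integrand_powR.
rewrite integral_mkcond; apply: eq_integral => y _.
rewrite patchE mem_setE in_itv/= /RL_integrand /truncpow addrK subr_gt0.
by case: (ltP 0 y); case: (ltP y x); rewrite ?mul0e ?mule0// -EFinM mulrC.
Qed.

Lemma integral_RL_integrand_powR r p x : 0 < r -> -1 < p -> 0 < x ->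
  (\int[mu]_(y in `[0%R, x]) (RL_integrand r (@powR R ^~ p) x y)%:E =
   (Gamma r * Gamma (p + 1) / Gamma (p + r + 1) * x `^ (p + r))%:E)%E.
Proof.
move=> r0 p1 x0; rewrite integral_RL_integrand_powR_convolution.
rewrite convolution_truncpow truncpow_gt0E// eBetaE -?ltrBlDr ?sub0r// -EFinM.
have -> : p + 1 + r - 1 = p + r by ring.
by rewrite (addrAC p 1) mulrC (mulrC (Gamma r)).
Qed.

Lemma RL_integral_powR r p x : 0 < r -> -1 < p -> 0 < x ->
  RL_integral r (@powR R ^~ p) x =
  Gamma (p + 1) / Gamma (p + r + 1) * x `^ (p + r).
Proof.
move=> r0 p1 x0.
rewrite /RL_integral /Rintegral integral_RL_integrand_powR//=.
by rewrite -!mulrA mulKf// gt_eqF ?Gamma_gt0.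
Qed.

Lemma RL_integrable_powR r p x : 0 < r -> -1 < p -> 0 < x ->
  mu.-integrable `[0%R, x] (fun y => (RL_integrand r (@powR R ^~ p) x y)%:E).
Proof.
move=> r0 p1 x0; apply/integrableP; split.
  apply/measurable_EFinP/measurable_funTS.
  exact: measurable_RL_integrand_powR.
under eq_integral do rewrite gee0_abs ?lee_fin ?mulr_ge0 ?powR_ge0//.
by rewrite integral_RL_integrand_powR// ltry.
Qed.

Let near_RL_integral_powR r p x : 0 < r -> -1 < p -> 0 < x ->
  \near x, RL_integral r (@powR R ^~ p) x =
           Gamma (p + 1) / Gamma (p + r + 1) * x `^ (p + r).
Proof.
move=> r0 p1 x0; near=> y.
by apply: RL_integral_powR => //; near: y; exact: lt_nbhsr.
Unshelve. all: by end_near. Qed.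

Lemma RL_derivable_powR (k : nat) s p : s < k%:R -> -1 < p ->
  RL_derivable k s (@powR R ^~ p).
Proof.
rewrite -subr_gt0 => ks p1 x x0; split=> [|j _].
  exact: RL_integrable_powR.
have dmono := @derivable1n_monomial R
  (Gamma (p + 1) / Gamma (p + (k%:R - s) + 1)) (p + (k%:R - s)) j x x0.
apply: near_eq_derivable dmono; apply: near_eq_derive1n.
by near=> y; apply/esym; near: y; exact: near_RL_integral_powR.
Unshelve. all: by end_near. Qed.

Lemma RL_deriv_powR (k : nat) s p x : s < k%:R -> -1 < p -> -1 < p - s ->
    0 < x ->
  RL_deriv k s (@powR R ^~ p) x =
  Gamma (p + 1) / Gamma (p - s + 1) * x `^ (p - s).
Proof.
rewrite -subr_gt0 => ks p1 ps1 x0.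
have pks : p + (k%:R - s) - k%:R = p - s by ring.
have ps0 : 0 < p - s + 1 by rewrite -ltrBlDr sub0r.
rewrite /RL_deriv.
rewrite (nbhs_singleton (near_eq_derive1n k (near_RL_integral_powR _ _ _)))//.
rewrite derive1n_monomial// pks.
have falling : Gamma (p + (k%:R - s) + 1) =
    \prod_(i < k) (p + (k%:R - s) - i%:R) * Gamma (p - s + 1).
  by rewrite (@Gamma_falling _ _ k) pks.
have : Gamma (p + (k%:R - s) + 1) != 0 by rewrite gt_eqF// Gamma_gt0//; lra.
rewrite falling mulf_eq0 => /norP[prod_neq0 Gamma_neq0].
by field; rewrite Gamma_neq0.
Qed.

Lemma RL_deriv_powR_mul_swap (k m : nat) s p x : s < k%:R -> p < m%:R ->
    -1 < s -> -1 < p -> `|p - s| < 1 -> 0 < x ->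
  RL_deriv k s (@powR R ^~ p) x * RL_deriv m p (@powR R ^~ s) x =
  (Gamma (p + 1) * Gamma (s + 1)) / (Gamma (p - s + 1) * Gamma (s - p + 1)).
Proof.
move=> sk pm s1 p1; rewrite ltr_norml => /andP[ps sp] x0.
rewrite !RL_deriv_powR//; last by lra.
have -> : x `^ (s - p) = (x `^ (p - s))^-1 by rewrite -powRN opprB.
by rewrite mulrACA divff ?gt_eqF ?powR_gt0// mulr1 mulf_div.
Qed.

End riemann_liouville_powers.

Section bounds_on_expR1_and_pi.
Context {R : realType}.
Implicit Types x : R.

Lemma expr1Dx_le_expR x (n : nat) : -1 <= x -> (1 + x) ^+ n <= expR (x * n%:R).
Proof.
move=> x1; rewrite expRM_natr lerXn2r ?nnegrE ?expR_ge0 ?expR_ge1Dx//.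
by rewrite -lerBlDl sub0r.
Qed.

Lemma expR1_gt73 : 7 / 3 < expR 1 :> R.
Proof.
have : (1 + 3^-1) ^+ 3 <= expR (3^-1 * 3%:R) :> R.
  by apply: expr1Dx_le_expR; lra.
by rewrite mulVf//; apply: lt_le_trans; lra.
Qed.

Lemma expR1_lt3 : expR 1 < 3 :> R.
Proof.
have : (1 - 6^-1) ^+ 6 <= expR (- 6^-1 * 6%:R) :> R.
  by apply: expr1Dx_le_expR; lra.
rewrite mulNr mulVf// expRN => expRV.
rewrite -[ltRHS]invrK -[ltLHS]invrK ltf_pV2 ?posrE ?invr_gt0 ?expR_gt0//.
by apply: lt_le_trans expRV; lra.
Qed.

Lemma le_id_tan x : 0 <= x < pi / 2 -> x <= tan x.
Proof.
move=> /andP[]; rewrite le_eqVlt => /predU1P[<- _|x0 xpi].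
  by rewrite tan0.
have cos_neq0 (y : R) : 0 <= y <= x -> cos y != 0.
  move=> /andP[y0 yx]; rewrite gt_eqF// cos_gt0_pihalf//.
  rewrite (le_lt_trans yx)// andbT (lt_le_trans _ y0)//.
  by rewrite oppr_lt0 divr_gt0// pi_gt0.
have [||y] := @MVT R tan (fun y => (cos y) ^- 2) 0 x x0.
- move=> y; rewrite in_itv/= => /andP[y0 yx].
  by apply: is_derive_tan; rewrite cos_neq0// !ltW.
- apply: derivable_within_continuous => y; rewrite in_itv/= => y0x.
  by apply: derivable_tan; exact: cos_neq0.
rewrite in_itv/= => /andP[y0 yx]; rewrite tan0 !subr0 => ->.
rewrite cos2_tan2; last by rewrite cos_neq0// !ltW.
by rewrite ler_peMl ?(ltW x0)// lerDl sqr_ge0.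
Qed.

(* [t = tan (pi / 8)] solves [t^2 + 2 t = 1], so [pi / 8 <= t < 5 / 12]. *)
Lemma pi_lt103 : pi < 10 / 3 :> R.
Proof.
have pi0 := @pi_gt0 R.
have : pi / 8 <= tan (pi / 8) :> R by apply: le_id_tan; lra.
have cos_neq0 : cos (pi / 8) != 0 :> R.
  by rewrite gt_eqF// cos_gt0_pihalf//; lra.
have := tan_mulr2n cos_neq0.
rewrite (_ : (pi / 8) *+ 2 = pi / 4 :> R); last by field.
rewrite tan_piquarter; set t := tan _ => t_eq pit.
have t_neq0 : 1 - t ^+ 2 != 0.
  apply/eqP => t0; move: t_eq; rewrite t0 invr0 mulr0 => /eqP.
  by rewrite oner_eq0.
have : 1 - t ^+ 2 = t *+ 2 by rewrite -[RHS](divfK t_neq0) -t_eq mul1r.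
by nra.
Qed.

Lemma norm_pi_sub_expR1_lt1 : `|pi - expR 1| < 1 :> R.
Proof.
have := expR1_gt73; have := expR1_lt3; have := pi_lt103; have := @pi_ge2 R.
by rewrite ltr_norml; lra.
Qed.

End bounds_on_expR1_and_pi.

Theorem mainTheorem8 (R : realType) (k m : nat)
    (hk : (expR 1 : R) < k%:R) (hm : (pi : R) < m%:R) :
  let e : R := expR 1 in
  let p : R := pi in
  [/\ RL_derivable k e (fun x => x `^ p),
      RL_derivable m p (fun x => x `^ e) &
      forall x : R, 0 < x ->
        [/\ RL_deriv k e (fun x => x `^ p) x
              = Gamma (p + 1) / Gamma (p - e + 1) * x `^ (p - e),
            RL_deriv m p (fun x => x `^ e) x
              = Gamma (e + 1) / Gamma (e - p + 1) * x `^ (e - p) &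
            RL_deriv k e (fun x => x `^ p) x * RL_deriv m p (fun x => x `^ e) x
              = (Gamma (p + 1) * Gamma (e + 1))
                / (Gamma (p - e + 1) * Gamma (e - p + 1))]].
Proof.
move=> e p.
have e_gtN1 : -1 < e by rewrite (lt_trans _ (expR_gt0 1)).
have p_gtN1 : -1 < p by rewrite (lt_trans _ (pi_gt0 R)).
have pe_lt1 : `|p - e| < 1 := norm_pi_sub_expR1_lt1.
have /andP[pe_gtN1 _] : -1 < p - e < 1 by rewrite -ltr_norml.
have /andP[ep_gtN1 _] : -1 < e - p < 1 by rewrite -ltr_norml distrC.
split=> [||x x0]; [exact: RL_derivable_powR..|split].
- exact: RL_deriv_powR.
- exact: RL_deriv_powR.
- exact: RL_deriv_powR_mul_swap.
Qed.
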